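(* For every $k,m,n,r,s\in\mathbb{N}$ such that $k\mid mnrs$, we have $$N(m,n,r,s;k)= \sum \varphi(x_3)\, \varphi(y_3)\, \varphi(z_3)\, \varphi(t_3)\, F(u,v),$$ where the sum is over all $$(x_1,x_2,x_3,x_4,x_5,y_1,y_2,y_3,y_4,y_5,z_1,z_2,z_3,z_4,z_5,t_1,t_2,t_3,t_4,t_5)\in\mathbb{N}^{20}$$ satisfying the following $11$ conditions: (1) $x_1x_2x_3=m$, (2) $x_3x_4x_5=n$, (3) $y_1y_2y_3=\gcd(x_1,x_4)$, (4) $y_3y_4y_5=x_3\operatorname{lcm}(x_1,x_4)$, (5) $z_1z_2z_3=r$, (6) $z_3z_4z_5=s$, (7) $t_1t_2t_3=\gcd(z_1,z_4)$, (8) $t_3t_4t_5=z_3\operatorname{lcm}(z_1,z_4)$, (9) $\gcd(y_2,y_5)=\gcd(t_2,t_5)=:u$, (10) $y_3\operatorname{lcm}(y_2,y_5)= t_3\operatorname{lcm}(t_2,t_5)=:v$, (11) $x_1x_3x_4t_1t_3t_4=k$.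
   Context: $\mathbb{N}=\{1,2,\ldots\}$ and $\mathbb{Z}_n$ is the additive group of residue classes modulo $n$. $N(m,n,r,s;k)$ denotes the number of subgroups of order $k$ of the group $\mathbb{Z}_m\times\mathbb{Z}_n\times\mathbb{Z}_r\times\mathbb{Z}_s$. $\varphi$ is Euler's totient function. $F(u,v)$ denotes the number of automorphisms of the group $\mathbb{Z}_u\times\mathbb{Z}_v$. *)

(* Defs.v *)
From mathcomp Require Import all_boot all_fingroup all_algebra.
From mathcomp Require Import boolp classical_sets functions cardinality.
From mathcomp Require Import fsbigop.
From mathcomp Require Import zify.

Set Implicit Arguments.
Unset Strict Implicit.
Unset Printing Implicit Defensive.

(* Z_n for n >= 1: the ordinal type 'I_n.+1 carries the group law of addition
   modulo n.+1.  The notation 'Z_n is unsuitable, since 'Z_1 has two elements. *)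
Notation cyc n := 'I_n.-1.+1.

Definition numSubgroups (m n r s k : nat) : nat :=
  #|[pred H : {group cyc m * cyc n * cyc r * cyc s} | #|H| == k]|.

Definition numAut (u v : nat) : nat := #|Aut [set: cyc u * cyc v]%G|.

Notation nat5 := (nat * nat * nat * nat * nat)%type.

Definition pos5 (a : nat5) : Prop :=
  let: (a1, a2, a3, a4, a5) := a in
  [/\ 0 < a1, 0 < a2, 0 < a3, 0 < a4 & 0 < a5].

Definition indices (m n r s k : nat) : set (nat5 * nat5 * nat5 * nat5) :=
  fun w =>
  let: (x, y, z, t) := w in
  let: (x1, x2, x3, x4, x5) := x in
  let: (y1, y2, y3, y4, y5) := y in
  let: (z1, z2, z3, z4, z5) := z in
  let: (t1, t2, t3, t4, t5) := t in
  [/\ pos5 x, pos5 y, pos5 z & pos5 t] /\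
  (x1 * x2 * x3 = m /\
   x3 * x4 * x5 = n /\
   y1 * y2 * y3 = gcdn x1 x4 /\
   y3 * y4 * y5 = x3 * lcmn x1 x4 /\
   z1 * z2 * z3 = r /\
   z3 * z4 * z5 = s /\
   t1 * t2 * t3 = gcdn z1 z4 /\
   t3 * t4 * t5 = z3 * lcmn z1 z4 /\
   gcdn y2 y5 = gcdn t2 t5 /\
   y3 * lcmn y2 y5 = t3 * lcmn t2 t5 /\
   x1 * x3 * x4 * t1 * t3 * t4 = k).

Definition summand (w : nat5 * nat5 * nat5 * nat5) : nat :=
  let: (x, y, z, t) := w in
  let: (x1, x2, x3, x4, x5) := x in
  let: (y1, y2, y3, y4, y5) := y in
  let: (z1, z2, z3, z4, z5) := z in
  let: (t1, t2, t3, t4, t5) := t in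
  let u := gcdn y2 y5 in
  let v := y3 * lcmn y2 y5 in
  totient x3 * totient y3 * totient z3 * totient t3 * numAut u v.

Lemma dvd_bound B a : 0 < B -> a %| B -> `I_B.+1%classic a.
Proof. by move=> B0 /(dvdn_leq B0); rewrite /= ltnS. Qed.

(* \big[addn/0]_(w \in A) F w is 0 by convention when F has infinite support on
   A; this lemma shows that the convention plays no role for A = indices. *)
Lemma finite_indices m n r s k : finite_set (indices m n r s k).
Proof.
set A : set nat5 := (`I_(m * n).+1 `*` `I_(m * n).+1 `*` `I_(m * n).+1
  `*` `I_(m * n).+1 `*` `I_(m * n).+1)%classic.
set B : set nat5 := (`I_(r * s).+1 `*` `I_(r * s).+1 `*` `I_(r * s).+1
  `*` `I_(r * s).+1 `*` `I_(r * s).+1)%classic.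
have fA : finite_set A by do !apply: finite_setX; exact: finite_II.
have fB : finite_set B by do !apply: finite_setX; exact: finite_II.
apply: (@sub_finite_set _ _ (A `*` A `*` B `*` B)%classic); last first.
  by do !apply: finite_setX.
have key a1 a2 a3 a4 a5 b1 b2 b3 b4 b5 :
    pos5 (a1, a2, a3, a4, a5) ->
    b1 * b2 * b3 = gcdn a1 a4 -> b3 * b4 * b5 = a3 * lcmn a1 a4 ->
    let M := (a1 * a2 * a3) * (a3 * a4 * a5) in
    let S := (`I_M.+1 `*` `I_M.+1 `*` `I_M.+1 `*` `I_M.+1 `*` `I_M.+1)%classic
    in S (a1, a2, a3, a4, a5) /\ S (b1, b2, b3, b4, b5).
  case=> p1 p2 p3 p4 p5 e1 e2 M S.
  have M0 : 0 < M by rewrite !muln_gt0 p1 p2 p3 p4 p5.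
  have g : gcdn a1 a4 %| M.
    by rewrite (dvdn_trans (dvdn_gcdl _ _))// /M -!mulnA dvdn_mulr.
  have l : a3 * lcmn a1 a4 %| M.
    apply: (@dvdn_trans (a3 * (a1 * a4))).
      by rewrite dvdn_pmul2l// dvdn_lcm dvdn_mulr// dvdn_mull.
    by apply/dvdnP; exists (a2 * a3 * a5); rewrite /M; nia.
  rewrite -e1 in g; rewrite -e2 in l.
  have d c : c %| M -> `I_M.+1%classic c := dvd_bound M0.
  split; do !split; apply: d.
  - by rewrite /M -!mulnA dvdn_mulr.
  - by rewrite /M -!mulnA dvdn_mull// dvdn_mulr.
  - by rewrite /M dvdn_mulr// dvdn_mull.
  - by rewrite /M dvdn_mull// dvdn_mulr// dvdn_mull.
  - by rewrite /M !dvdn_mull.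
  - by apply: dvdn_trans g; rewrite -mulnA dvdn_mulr.
  - by apply: dvdn_trans g; rewrite dvdn_mulr// dvdn_mull.
  - by apply: dvdn_trans g; rewrite dvdn_mull.
  - by apply: dvdn_trans l; rewrite dvdn_mulr// dvdn_mull.
  - by apply: dvdn_trans l; rewrite dvdn_mull.
move=> -[[[[[[[x1 x2] x3] x4] x5] [[[[y1 y2] y3] y4] y5]]
  [[[[z1 z2] z3] z4] z5]] [[[[t1 t2] t3] t4] t5]].
rewrite /indices => -[[px _ pz _]].
move=> [em [en [e3 [e4 [er [es [e7 [e8 _]]]]]]]].
have [Ax Ay] := key _ _ _ _ _ _ _ _ _ _ px e3 e4.
have [Bz Bt] := key _ _ _ _ _ _ _ _ _ _ pz e7 e8.
rewrite em en in Ax Ay; rewrite er es in Bz Bt.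
by split=> //; split=> //; split.
Qed.

(* Main.v *)
(* Goursat's lemma is used twice.  A subgroup L of G x H is the same as a chain
   B <| A <= G, a chain D <| C <= H and an isomorphism A / B -> C / D, and
   |L| = |A| |D|; so the L with given A, B, C, D number |Aut (A / B)| if
   A / B and C / D are isomorphic, and 0 otherwise.

   For G = Z_m, H = Z_n the four subgroups are determined by their orders, the
   quotients are cyclic of order x3, and the quintuple (x1, ..., x5) records
   |B| = x1, |A| = x1 x3, |D| = x4, |C| = x3 x4.  Hence x is the datum of
   phi(x3) subgroups K of Z_m x Z_n, and K and (Z_m x Z_n) / K have exponents
   x3 lcm(x1, x4) and x3 lcm(x2, x5).  An abelian group of rank at most 2 is
   determined by its order and exponent, so K is Z_gcd(x1, x4) x
   Z_(x3 lcm(x1, x4)), and the subgroups of K are in turn counted by the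
   quintuples y.

   For G = Z_m x Z_n, H = Z_r x Z_s the chains are thus counted by the pairs
   (x, y) and (z, t), and A / B is Z_u x Z_v. *)
Require Import Defs.
From mathcomp Require Import boolp classical_sets functions cardinality.
From mathcomp Require Import fsbigop.
(* Imported last: classical_sets shadows subsetT, setTI and other lemmas on
   finite sets. *)
From mathcomp Require Import all_boot all_fingroup all_algebra all_solvable.
From mathcomp Require Import zify.

Set Implicit Arguments.
Unset Strict Implicit.
Unset Printing Implicit Defensive.

(** * Goursat's lemma *)

Local Open Scope group_scope.

Section Goursat.

Variables gT hT : finGroupType.
Implicit Types K : {group gT * hT}.

(** For K in G x H, [proj1G], [slice1], [proj2G], [slice2] are the groups A, B, C, D of Goursat's
    lemma. *)
Definition proj1G K : {group gT} := (@fst gT hT @* K)%G.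
Definition slice1 K : {group gT} := (pairg1 hT @*^-1 K)%G.
Definition proj2G K : {group hT} := (@snd gT hT @* K)%G.
Definition slice2 K : {group hT} := (@pair1g gT hT @*^-1 K)%G.

Lemma proj1GP K x : reflect (exists y, (x, y) \in K) (x \in proj1G K).
Proof.
apply: (iffP morphimP) => [[[a b] _ Kab ->]|[y Kxy]]; first by exists b.
by exists (x, y); rewrite ?inE.
Qed.

Lemma proj2GP K y : reflect (exists x, (x, y) \in K) (y \in proj2G K).
Proof.
apply: (iffP morphimP) => [[[a b] _ Kab ->]|[x Kxy]]; first by exists a.
by exists (x, y); rewrite ?inE.
Qed.

Lemma mem_slice1 K x : (x \in slice1 K) = ((x, 1) \in K).
Proof. by rewrite !inE. Qed.

Lemma mem_slice2 K y : (y \in slice2 K) = ((1, y) \in K).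
Proof. by rewrite !inE. Qed.

Lemma slice1_normal K : slice1 K <| proj1G K.
Proof.
apply/andP; split.
  by apply/subsetP => x; rewrite mem_slice1 => Kx; apply/proj1GP; exists 1.
apply/subsetP => x /proj1GP[y Kxy]; rewrite inE; apply/subsetP => z.
case/imsetP => b Kb ->{z}; move: Kb; rewrite !mem_slice1 => Kb.
have -> : (b ^ x, 1) = (b, 1) ^ (x, y) :> gT * hT.
  by rewrite [RHS]/conjg /=; congr (_, _); rewrite /= ?mul1g ?mulVg.
by rewrite groupJ.
Qed.

Lemma slice2_normal K : slice2 K <| proj2G K.
Proof.
apply/andP; split.
  by apply/subsetP => x; rewrite mem_slice2 => Kx; apply/proj2GP; exists 1.
apply/subsetP => y /proj2GP[x Kxy]; rewrite inE; apply/subsetP => z.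
case/imsetP => b Kb ->{z}; move: Kb; rewrite !mem_slice2 => Kb.
have -> : (1, b ^ y) = (1, b) ^ (x, y) :> gT * hT.
  by rewrite [RHS]/conjg /=; congr (_, _); rewrite /= ?mul1g ?mulVg.
by rewrite groupJ.
Qed.

(** The kernel of the first projection on K consists of pairs (1, y), hence is a copy of
    [slice2 K]. *)
Lemma card_subprod K : #|K| = (#|proj1G K| * #|slice2 K|)%N.
Proof.
rewrite /= card_morphim setTI -(LagrangeI K ('ker (@fst gT hT))) mulnC.
congr (_ * _)%N.
rewrite -(card_injm (injm_pair1g gT hT) (subsetT _)).
apply: eq_card => -[x y].
rewrite morphim_pair1g !inE /=; case: eqP => [-> |_]; first by rewrite andbT.
by rewrite andbF.
Qed.

(** K matches the cosets of B in A one to one with the cosets of D in C; [h] is this matching. *)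
Lemma goursat_iso K :
  exists h : {morphism (proj1G K / slice1 K) >-> coset_of (slice2 K)},
  [/\ 'injm h, h @* (proj1G K / slice1 K) = proj2G K / slice2 K
    & forall x y, (x, y) \in K ->
        h (coset (slice1 K) x) = coset (slice2 K) y].
Proof.
set A := proj1G K; set B := slice1 K; set C := proj2G K; set D := slice2 K.
have nBA : A \subset 'N(B) := normal_norm (slice1_normal K).
have nDC : C \subset 'N(D) := normal_norm (slice2_normal K).
have KA x y : (x, y) \in K -> x \in A by move=> Kxy; apply/proj1GP; exists y.
have KC x y : (x, y) \in K -> y \in C by move=> Kxy; apply/proj2GP; exists x.
(* Well-definedness and injectivity at once: the quotient of the two pairs is the product of (x
   x'^-1, 1) and (1, y y'^-1), so one factor lies in K exactly when the other does. *)
have coset_eq x y x' y' : (x, y) \in K -> (x', y') \in K ->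
    (coset B x == coset B x') = (coset D y == coset D y').
  move=> K1 K2; have N1 := subsetP nBA _ (KA _ _ K1).
  have N2 := subsetP nBA _ (KA _ _ K2); have M1 := subsetP nDC _ (KC _ _ K1).
  have M2 := subsetP nDC _ (KC _ _ K2).
  have e1 : (coset B x == coset B x') = (x * x'^-1 \in B).
    apply/eqP/idP => [e|Bx]; last by apply/rcoset_kercosetP; rewrite // mem_rcoset.
    by have /rcoset_kercosetP := e; rewrite mem_rcoset => ->.
  have e2 : (coset D y == coset D y') = (y * y'^-1 \in D).
    apply/eqP/idP => [e|Bx]; last by apply/rcoset_kercosetP; rewrite // mem_rcoset.
    by have /rcoset_kercosetP := e; rewrite mem_rcoset => ->.
  rewrite {}e1 {}e2 mem_slice1 mem_slice2.
  have K3 : (x * x'^-1, y * y'^-1) \in K by exact: groupM K1 (groupVr K2).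
  have E : (x * x'^-1, y * y'^-1) = (x * x'^-1, 1) * (1, y * y'^-1) :> gT * hT.
    by congr (_, _); rewrite /= ?mulg1 ?mul1g.
  apply/idP/idP => K4; first by rewrite -(groupMl _ K4) -E.
  by rewrite -(groupMr _ K4) -E.
(* Any representative pair in K will do; the default 1 is reached only for X outside A / B. *)
pose h X := coset D (odflt 1 [pick p in K | coset B p.1 == X]).2.
have hE x y : (x, y) \in K -> h (coset B x) = coset D y.
  move=> Kxy; rewrite /h; case: pickP => [[x' y'] /=|/(_ (x, y))].
    by case/andP=> K' e; apply/eqP; rewrite -(coset_eq _ _ _ _ K' Kxy).
  by rewrite /= Kxy eqxx.
have hM : {in A / B &, {morph h : X Y / X * Y}}.
  move=> _ _
    /morphimP[x Nx /proj1GP[y Kxy] ->]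
    /morphimP[x' Nx' /proj1GP[y' Kxy'] ->].
  rewrite -morphM // (hE _ (y * y')) ?(hE _ _ Kxy) ?(hE _ _ Kxy') ?morphM //.
  - exact: subsetP nDC _ (KC _ _ Kxy).
  - exact: subsetP nDC _ (KC _ _ Kxy').
  - exact: groupM Kxy Kxy'.
exists (Morphism hM); split; last exact: hE.
  apply/injmP => _ _
    /morphimP[x Nx /proj1GP[y Kxy] ->]
    /morphimP[x' Nx' /proj1GP[y' Kxy'] ->] /=.
  rewrite (hE _ _ Kxy) (hE _ _ Kxy') => /eqP.
  by rewrite -(coset_eq _ _ _ _ Kxy Kxy') => /eqP.
rewrite morphimEdom; apply/setP => Y; apply/imsetP/morphimP.
  move=> [_ /morphimP[x Nx /proj1GP[y Kxy] ->]] /= ->.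
  exists y; rewrite ?(hE _ _ Kxy) ?(KC _ _ Kxy) //.
  exact: subsetP nDC _ (KC _ _ Kxy).
move=> [y Ny /proj2GP[x Kxy] ->]; exists (coset B x); last by rewrite /= (hE _ _ Kxy).
by apply: mem_quotient; apply: KA Kxy.
Qed.

Lemma proj_slice_isog K : proj1G K / slice1 K \isog proj2G K / slice2 K.
Proof. by have [h [injh imh _]] := goursat_iso K; apply/isogP; exists h. Qed.

(** Once an isomorphism g from A / B to C / D is fixed, all others are g after a unique automorphism
    of A / B, and the subgroups with data (A, B, C, D) are the preimages in A x C of their
    graphs. *)
Lemma card_goursat_fiber (A B : {group gT}) (C D : {group hT}) :
    B <| A -> D <| C ->
  #|[pred K | (proj1G K, slice1 K, proj2G K, slice2 K) == (A, B, C, D)]|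
  = if A / B \isog C / D then #|Aut (A / B)| else 0%N.
Proof.
move=> nBA nDC; have [/isogP[g injg img]|/negP niso] := boolP (isog _ _); last first.
  apply: eq_card0 => K; apply/negP => /eqP[eA eB eC eD].
  by apply: niso; have := proj_slice_isog K; rewrite eA eB eC eD.
have NA x : x \in A -> x \in 'N(B) := subsetP (normal_norm nBA) x.
have NC x : x \in C -> x \in 'N(D) := subsetP (normal_norm nDC) x.
pose graph (a : {perm coset_of B}) :=
  [set p : gT * hT | [&& p.1 \in A, p.2 \in C
                       & g (a (coset B p.1)) == coset D p.2]].
have graph_group a : a \in Aut (A / B) -> group_set (graph a).
  move=> Aa; have gaM x x' : x \in A -> x' \in A ->
      g (a (coset B (x * x'))) = g (a (coset B x)) * g (a (coset B x')).
    move=> Ax Ax'; rewrite morphM ?NA // -(autmE Aa) morphM ?mem_quotient //.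
    by rewrite morphM ?(autmE Aa) ?Aut_closed ?mem_quotient.
  apply/group_setP; split=> [|[x y] [x' y']].
    by rewrite inE !group1 /= !morph1 -(autmE Aa) !morph1.
  rewrite !inE /= => /and3P[Ax Cy /eqP e] /and3P[Ax' Cy' /eqP e'].
  by rewrite !groupM //= gaM // morphM ?NC // e e'.
(* [graph a] is known to be a group for automorphisms a; taking the generated group gives a total
   function and adds nothing in that case. *)
pose K a := <<graph a>>%G.
have KE a x y : a \in Aut (A / B) -> ((x, y) \in K a)
    = [&& x \in A, y \in C & g (a (coset B x)) == coset D y].
  by move=> Aa; rewrite /K /= -[graph a]/(gval (Group (graph_group a Aa))) genGid inE.
have lift a x : a \in Aut (A / B) -> x \in A -> exists2 y, (x, y) \in K a & y \in C.
  move=> Aa Ax; have: g (a (coset B x)) \in C / D.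
    by rewrite -img mem_morphim ?Aut_closed ?mem_quotient.
  by case/morphimP=> y Ny Cy e; exists y; rewrite // KE // Ax Cy e eqxx.
have Kinj : {in Aut (A / B) &, injective K}.
  move=> a b Aa Ab eK; apply: eq_Aut (Aa) (Ab) _ => _ /morphimP[x Nx Ax ->].
  have [y Ka Cy] := lift a x Aa Ax; have Kb := Ka; rewrite eK in Kb.
  move: Ka Kb; rewrite !KE // Ax Cy /= => /eqP e1 /eqP e2.
  by apply: (injmP injg); rewrite ?Aut_closed ?mem_quotient // e1 e2.
rewrite -(card_in_imset Kinj); apply: eq_card => L; rewrite !inE.
apply/eqP/imsetP => [[eA eB eC eD]|[a Aa ->{L}]]; last first.
  have eA : proj1G (K a) = A.
    apply/val_inj/setP => x; apply/proj1GP/idP => [[y]|Ax].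
      by rewrite KE // => /andP[].
    by have [y Kxy _] := lift a x Aa Ax; exists y.
  have eC : proj2G (K a) = C.
    apply/val_inj/setP => y; apply/proj2GP/idP => [[x]|Cy].
      by rewrite KE // => /and3P[].
    have: coset D y \in g @* (A / B) by rewrite img mem_quotient.
    case/morphimP => X _ AX eX; have: a^-1 X \in A / B.
      by rewrite Aut_closed ?groupV.
    case/morphimP => x _ Ax ex; exists x; rewrite KE // Ax Cy /=.
    by rewrite eX -[coset_morphism B x]/(coset B x) in ex *; rewrite -ex permKV.
  have eB : slice1 (K a) = B.
    apply/val_inj/setP => x; rewrite mem_slice1 KE // group1 morph1 /=.
    have [Ax|/=] := boolP (x \in A); last first.
      by move=> /negP nAx; apply/esym/negP => /(subsetP (normal_sub nBA)).
    rewrite /= -(autmE Aa) (morph_injm_eq1 injg) ?(morph_injm_eq1 (injm_autm Aa)) //.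
    - by apply/eqP/idP => [e|/coset_id //]; apply: (coset_idr _ e); apply: NA.
    - by rewrite mem_quotient.
    - by rewrite autmE Aut_closed ?mem_quotient.
  have eD : slice2 (K a) = D.
    apply/val_inj/setP => y; rewrite mem_slice2 KE // group1 morph1 /=.
    rewrite -(autmE Aa) !morph1.
    have [Cy|/=] := boolP (y \in C); last first.
      by move=> /negP nCy; apply/esym/negP => /(subsetP (normal_sub nDC)).
    by rewrite eq_sym; apply/eqP/idP => [e|/coset_id //]; apply: (coset_idr _ e); apply: NC.
  by rewrite eA eB eC eD.
(* The automorphism belonging to L is the inverse of g after the isomorphism h that L defines. *)
have := goursat_iso L; rewrite eA eB eC eD => -[h [injh imh hE]].
have hg X : X \in A / B -> h X \in g @* (A / B).
  by move=> AX; rewrite img; have := mem_morphim h AX AX; rewrite imh.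
have fM : {in A / B &, {morph (fun X => invm injg (h X)) : X Y / X * Y}}.
  by move=> X Y AX AY; rewrite morphM // morphM ?hg.
pose f := Morphism fM.
have injf : 'injm f.
  apply/injmP => X Y AX AY /= e; apply: (injmP injh) => //.
  by rewrite -(invmK injg (hg _ AX)) e invmK ?hg.
have imf : f @* (A / B) = A / B.
  apply/morphim_fixP => //; apply/subsetP => _ /morphimP[X _ AX ->] /=.
  by have /morphimP[Y _ AY ->] := hg _ AX; rewrite invmE.
exists (aut injf imf); first exact: Aut_aut.
apply/val_inj/setP => -[x y]; rewrite KE ?Aut_aut //.
have gE z : z \in A -> g (aut injf imf (coset B z)) = h (coset B z).
  by move=> Az; rewrite autE ?mem_quotient //= invmK ?hg ?mem_quotient.
apply/idP/and3P => [Lxy|[Ax Cy]].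
  have Ax : x \in A by rewrite -eA; apply/proj1GP; exists y.
  split=> //; last by rewrite gE // (hE _ _ Lxy).
  by rewrite -eC; apply/proj2GP; exists x.
(* Some (x, y') lies in L; then y and y' have the same coset of D, so the two pairs differ by an
   element (1, d) of L. *)
rewrite gE //; have := Ax; rewrite -[in X in X -> _]eA => /proj1GP[y' Lxy'].
have Cy' : y' \in C by rewrite -eC; apply/proj2GP; exists x.
rewrite (hE _ _ Lxy') eq_sym => /eqP/rcoset_kercosetP.
rewrite mem_rcoset !NC // => /(_ isT isT); rewrite -[in X in X -> _]eD mem_slice2 => Ld.
have -> : (x, y) = (1, y * y'^-1) * (x, y') :> gT * hT.
  by congr (_, _); rewrite /= ?mul1g // -mulgA mulVg mulg1.
exact: groupM.
Qed.

(** The subgroups are grouped by their quadruple (A, B, C, D); the isomorphism test enters as a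
    factor 0 or 1. *)
Lemma sum_goursat (F : {group gT} -> {group gT} -> {group hT} -> {group hT} -> nat) :
  \sum_(K : {group gT * hT}) F (proj1G K) (slice1 K) (proj2G K) (slice2 K)
  = \sum_(A : {group gT}) \sum_(B : {group gT} | B <| A)
    \sum_(C : {group hT}) \sum_(D : {group hT} | D <| C)
      F A B C D * (A / B \isog C / D) * #|Aut (A / B)|.
Proof.
pose T : finType := ({group gT} * {group gT} * {group hT} * {group hT})%type.
pose p K : T := (proj1G K, slice1 K, proj2G K, slice2 K).
pose Q (t : T) := (t.1.1.2 <| t.1.1.1) && (t.2 <| t.1.2).
rewrite (partition_big p Q) /=; last first.
  by move=> K _; rewrite /Q /= slice1_normal slice2_normal.
rewrite (eq_bigr (fun t : T => F t.1.1.1 t.1.1.2 t.1.2 t.2 *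
   (t.1.1.1 / t.1.1.2 \isog t.1.2 / t.2) * #|Aut (t.1.1.1 / t.1.1.2)|)%N); last first.
  move=> [[[A B] C] D] /andP[/= nBA nDC].
  rewrite (eq_bigr (fun=> F A B C D)); last by move=> K /eqP[<- <- <- <-].
  rewrite sum_nat_const mulnC -mulnA; congr (_ * _)%N.
  rewrite (eq_card (B := [pred K | p K == (A, B, C, D)])) ?card_goursat_fiber //.
  by case: ifP; rewrite ?mul1n ?mul0n.
under [RHS]eq_bigr => A _ do under eq_bigr => B _ do rewrite pair_big_dep /=.
under [RHS]eq_bigr => A _ do rewrite pair_big_dep /=.
rewrite pair_big_dep /=.
rewrite (reindex (fun t : {group gT} * ({group gT} * ({group hT} * {group hT})) =>
   (t.1, t.2.1, t.2.2.1, t.2.2.2) : T)) /=; first by apply: eq_bigl => -[A [B [C D]]].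
exists (fun t : T => (t.1.1.1, (t.1.1.2, (t.1.2, t.2)))).
  by case=> A [B [C D]].
by case=> [[[A B] C] D].
Qed.

End Goursat.

(** * Abelian groups of rank at most two *)

(** The invariant factors come with the largest first; the default 1 serves the trivial group, whose
    list is empty. *)
Lemma head_abelian_type (gT : finGroupType) (G : {group gT}) :
  abelian G -> head 1%N (abelian_type G) = exponent G.
Proof.
move=> cGG; rewrite /abelian_type (_ : <<G>>%G = G); last exact/val_inj/genGid.
case: #|G| (cardG_gt0 G) => // n _ /=; case: ifP => //=.
by rewrite cGG /= => /negbFE/eqP->; rewrite exponent1.
Qed.

Lemma prod_abelian_type (gT : finGroupType) (G : {group gT}) :
  abelian G -> (\prod_(d <- abelian_type G) d)%N = #|G|.
Proof.
move=> cGG; have [b defG <-] := abelian_structure cGG.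
by rewrite big_map -(bigdprod_card defG).
Qed.

(** There are at most two invariant factors: the first is the exponent, and the order then
    determines the second. *)
Lemma rank2_isog (gT hT : finGroupType) (G : {group gT}) (H : {group hT}) :
  abelian G -> abelian H -> 'r(G) <= 2 -> 'r(H) <= 2 ->
  (G \isog H) = (#|G| == #|H|) && (exponent G == exponent H).
Proof.
move=> cGG cHH; rewrite -(size_abelian_type cGG) -(size_abelian_type cHH).
move=> rG rH; apply/idP/andP => [iso|[/eqP eo /eqP ee]].
  by rewrite (card_isog iso) (exponent_isog iso).
rewrite eq_abelian_type_isog //; apply/eqP; move: eo ee.
rewrite -(head_abelian_type cGG) -(head_abelian_type cHH).
rewrite -(prod_abelian_type cGG) -(prod_abelian_type cHH).
have:= abelian_type_gt1 G; have:= abelian_type_gt1 H; move: rG rH.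
(* Lists of different lengths are ruled out because every invariant factor exceeds 1. *)
case: (abelian_type G) => [|a [|b [|? ?]]] //;
  case: (abelian_type H) => [|c [|d [|? ?]]] //= _ _;
  rewrite ?big_cons ?big_nil ?muln1 ?andbT.
- by move=> /[swap] _ /[swap] _ /[swap] <-.
- by move=> /andP[c1 _] _ _ e; move: c1; rewrite -e.
- by move=> _ a1 _ e; move: a1; rewrite e.
- by move=> _ _ _ ->.
- move=> /andP[c1 d1] a1 e1 e2; move: e1 d1; rewrite -e2 -{1}[a]muln1.
  by move/eqP; rewrite eqn_pmul2l ?(ltnW a1) // => /eqP <-.
- by move=> _ /andP[a1 _] _ e; move: a1; rewrite e.
- move=> c1 /andP[a1 b1] e1 e2; move: e1 b1; rewrite e2 -{2}[c]muln1.
  by move/eqP; rewrite eqn_pmul2l ?(ltnW c1) // => /eqP ->.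
- move=> /andP[c1 d1] _ e1 e2; move: e1; rewrite e2 => /eqP.
  by rewrite eqn_pmul2l ?(ltnW c1) // => /eqP ->.
Qed.

Section Products.

Variables gT hT : finGroupType.
Implicit Types K : {group gT * hT}.

Lemma expg_pair (x : gT) (y : hT) n : (x, y) ^+ n = (x ^+ n, y ^+ n).
Proof. by elim: n => [|n IH] //; rewrite !expgS IH. Qed.

Lemma exponent_subprod K :
  exponent K = lcmn (exponent (proj1G K)) (exponent (proj2G K)).
Proof.
apply/eqP; rewrite eqn_dvd dvdn_lcm !exponent_morphim !andbT.
apply/exponentP => -[x y] Kxy; rewrite expg_pair; congr (_, _).
  apply/eqP; rewrite -order_dvdn (dvdn_trans _ (dvdn_lcml _ _)) //.
  by apply: dvdn_exponent; apply/proj1GP; exists y.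
apply/eqP; rewrite -order_dvdn (dvdn_trans _ (dvdn_lcmr _ _)) //.
by apply: dvdn_exponent; apply/proj2GP; exists x.
Qed.

Lemma exponent_quotientP (rT : finGroupType) (H : {group rT}) n :
  H <| [set: rT] ->
  reflect (forall x, x ^+ n \in H) (exponent ([set: rT] / H) %| n).
Proof.
move=> nH; have N x : x \in 'N(H) by apply: subsetP (normal_norm nH) _ _; rewrite inE.
apply: (iffP exponentP) => [e x|e _ /morphimP[x _ _ ->]].
  apply: coset_idr => //; rewrite morphX //; apply: e.
  by rewrite mem_quotient ?inE.
by rewrite -morphX //=; apply: coset_id.
Qed.

(** Since (x, y) ^ e is the product of (x ^ e, 1) and (1, y ^ e), all e-th powers lie in K exactly
    when those of all (x, 1) and all (1, y) do. *)
Lemma exponent_quotient_subprod K :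
    abelian [set: gT] -> abelian [set: hT] -> abelian [set: gT * hT] ->
  exponent ([set: gT * hT] / K)
  = lcmn (exponent ([set: gT] / slice1 K)) (exponent ([set: hT] / slice2 K)).
Proof.
move=> cG cH cGH.
have n1 : slice1 K <| setT by rewrite -sub_abelian_normal ?subsetT.
have n2 : slice2 K <| setT by rewrite -sub_abelian_normal ?subsetT.
have n : K <| setT by rewrite -sub_abelian_normal ?subsetT.
have eP e : (exponent ([set: gT * hT] / K) %| e)
    = (exponent ([set: gT] / slice1 K) %| e) && (exponent ([set: hT] / slice2 K) %| e).
  apply/(exponent_quotientP e n)/andP => [eK|[]].
    split; [apply/(exponent_quotientP e n1) => x|apply/(exponent_quotientP e n2) => x].
      by rewrite mem_slice1; have := eK (x, 1); rewrite expg_pair expg1n.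
    by rewrite mem_slice2; have := eK (1, x); rewrite expg_pair expg1n.
  move=> /(exponent_quotientP e n1) e1 /(exponent_quotientP e n2) e2 [x y].
  move: (e1 x) (e2 y); rewrite expg_pair mem_slice1 mem_slice2 => K1 K2.
  have -> : (x ^+ e, y ^+ e) = (x ^+ e, 1) * (1, y ^+ e) :> gT * hT.
    by congr (_, _); rewrite /= ?mulg1 ?mul1g.
  exact: groupM.
apply/eqP; rewrite eqn_dvd eP dvdn_lcml dvdn_lcmr dvdn_lcm /=.
by rewrite -eP dvdnn.
Qed.

Lemma prod_cyclic_abelian :
  abelian [set: gT] -> abelian [set: hT] -> abelian [set: gT * hT].
Proof.
move=> /centsP cG /centsP cH; apply/centsP => -[x y] _ [x' y'] _.
by congr (_, _); [apply: cG | apply: cH]; rewrite inE.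
Qed.

(** With generators a and b of the factors, (a, 1) and (1, b) generate the product. *)
Lemma rank_prod_cyclic :
  cyclic [set: gT] -> cyclic [set: hT] -> 'r([set: gT * hT]) <= 2.
Proof.
move=> cG cH; rewrite -grank_abelian; last first.
  by apply: prod_cyclic_abelian; apply: cyclic_abelian.
have [a Ga] := cyclicP cG; have [b Hb] := cyclicP cH.
have gen : <<[set (a, 1); (1, b)]>> = [set: gT * hT].
  apply/eqP; rewrite eqEsubset subsetT /=; apply/subsetP => -[x y] _.
  have /cycleP[i ->] : x \in <[a]> by rewrite -Ga inE.
  have /cycleP[j ->] : y \in <[b]> by rewrite -Hb inE.
  have -> : (a ^+ i, b ^+ j) = (a, 1) ^+ i * (1, b) ^+ j :> gT * hT.
    by rewrite !expg_pair !expg1n; congr (_, _); rewrite /= ?mulg1 ?mul1g.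
  by rewrite groupM // groupX // mem_gen // !inE eqxx ?orbT.
have := grank_min [set (a, 1); (1, b) : gT * hT]; rewrite gen => /leq_trans.
by apply; rewrite cards2 ltnS leq_b1.
Qed.

End Products.

Local Close Scope group_scope.

(** The quotient is the second invariant factor, or 1 when there is none, and it divides the
    first. *)
Lemma exponent_rank2_dvdn (gT : finGroupType) (G : {group gT}) :
  abelian G -> 'r(G)%g <= 2 -> #|G| %/ exponent G %| exponent G.
Proof.
move=> cGG; rewrite -(size_abelian_type cGG) -(head_abelian_type cGG).
rewrite -(prod_abelian_type cGG).
have:= abelian_type_gt1 G; have:= abelian_type_dvdn_sorted G.
case: (abelian_type G) => [|a [|b [|? ?]]] //=;
  rewrite ?big_cons ?big_nil ?muln1 ?andbT //.
- by move=> _ a1 _; rewrite divnn (ltnW a1) dvd1n.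
- by move=> ba /andP[a1 _] _; rewrite mulKn // (ltnW a1).
Qed.

(** * Subgroups of products of two cyclic groups *)

Definition is_quint (m n : nat) (x : nat5) : bool :=
  let: (x1, x2, x3, x4, x5) := x in
  [&& 0 < x1, 0 < x2, 0 < x3, 0 < x4 & 0 < x5] &&
  ((x1 * x2 * x3 == m) && (x3 * x4 * x5 == n)).

(** An explicit finite list; entries up to m n suffice, since each entry of a solution divides m
    n. *)
Definition quints (m n : nat) : seq nat5 :=
  let r := iota 0 (m * n).+1 in
  [seq x <- [seq (p, x5) | p <- [seq (p, x4) | p <- [seq (p, x3) |
     p <- [seq (x1, x2) | x1 <- r, x2 <- r], x3 <- r], x4 <- r], x5 <- r]
  | is_quint m n x].

Lemma quints_uniq m n : uniq (quints m n).
Proof.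
by apply: filter_uniq; do 4!(apply: allpairs_uniq; rewrite ?iota_uniq //;
  last by move=> [? ?] [? ?] _ _).
Qed.

Lemma mem_quints m n x : (x \in quints m n) = is_quint m n x.
Proof.
rewrite mem_filter; apply: andb_idr.
case: x => [[[[x1 x2] x3] x4] x5] /andP[/and5P[p1 p2 p3 p4 p5] /andP[/eqP em /eqP en]].
have M a b : 0 < b -> a * b = m * n -> a \in iota 0 (m * n).+1.
  by move=> b0 <-; rewrite mem_iota add0n ltnS leq_pmulr.
have pairM (S T : eqType) (s : seq S) (t : seq T) a b :
    a \in s -> b \in t -> (a, b) \in [seq (y, z) | y <- s, z <- t].
  by move=> sa tb; apply/allpairsP; exists (a, b).
apply: (pairM); [apply: (pairM); [apply: (pairM); [apply: (pairM)|]|]|].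
- by apply: (M _ (x2 * x3 * n));
    rewrite ?muln_gt0 -?en -?em ?muln_gt0 ?p2 ?p3 ?p4 //; lia.
- by apply: (M _ (x1 * x3 * n));
    rewrite ?muln_gt0 -?en -?em ?muln_gt0 ?p1 ?p3 ?p4 //; lia.
- by apply: (M _ (x1 * x2 * n));
    rewrite ?muln_gt0 -?en -?em ?muln_gt0 ?p1 ?p2 ?p3 ?p4 //; lia.
- by apply: (M _ (m * x3 * x5));
    rewrite ?muln_gt0 -?en -?em ?muln_gt0 ?p1 ?p2 ?p3 ?p5 //; lia.
- by apply: (M _ (m * x3 * x4));
    rewrite ?muln_gt0 -?en -?em ?muln_gt0 ?p1 ?p2 ?p3 ?p4 //; lia.
Qed.

Lemma quintsP m n x1 x2 x3 x4 x5 :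
  reflect (pos5 (x1, x2, x3, x4, x5) /\ (x1 * x2 * x3 = m /\ x3 * x4 * x5 = n))
          ((x1, x2, x3, x4, x5) \in quints m n).
Proof.
rewrite mem_quints; apply: (iffP andP).
  by move=> [/and5P[? ? ? ? ?] /andP[/eqP ? /eqP ?]].
by move=> [[-> -> -> -> ->] [-> ->]]; rewrite !eqxx.
Qed.

(** The list [q] stands in for the range of [p], because [nat5] is not a finite type; each t is
    counted at the one entry equal to [p t]. *)
Lemma sum_fibers (T : finType) (I : eqType) (q : seq I) (p : T -> I)
    (F : T -> nat) (G : I -> nat) :
  uniq q -> (forall t, p t \in q) -> (forall t, F t = G (p t)) ->
  \sum_t F t = \sum_(x <- q) #|[pred t | p t == x]| * G x.
Proof.
move=> uq pq FG.
transitivity (\sum_t \sum_(x <- q | x == p t) G x).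
  by apply: eq_bigr => t _; rewrite -big_filter filter_pred1_uniq // big_seq1.
rewrite (exchange_big_dep predT) //=; apply: eq_bigr => x _.
rewrite sum_nat_const; congr (_ * _); apply: eq_card => t.
by rewrite !inE eq_sym.
Qed.

Section CyclicProduct.

Variables gT hT : finGroupType.
Hypotheses (cG : cyclic [set: gT]) (cH : cyclic [set: hT]).
Implicit Types K : {group gT * hT}.

Local Notation m := #|[set: gT]|.
Local Notation n := #|[set: hT]|.

(** The entries [x2] and [x5] are the indices of A in G and of C in H, and [x3] is the common order
    of A / B and C / D. *)
Definition quint_of K : nat5 :=
  (#|slice1 K|, m %/ #|proj1G K|, #|proj1G K| %/ #|slice1 K|,
   #|slice2 K|, n %/ #|proj2G K|).

Lemma card_proj_slice K : #|proj1G K| %/ #|slice1 K| = #|proj2G K| %/ #|slice2 K|.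
Proof.
rewrite (divg_normal (slice1_normal K)) (divg_normal (slice2_normal K)).
exact: card_isog (proj_slice_isog K).
Qed.

Lemma quint_ofE K x1 x2 x3 x4 x5 : quint_of K = (x1, x2, x3, x4, x5) ->
  [/\ (x1, x2, x3, x4, x5) \in quints m n,
      #|slice1 K| = x1, #|proj1G K| = x1 * x3, #|slice2 K| = x4
    & #|proj2G K| = x3 * x4].
Proof.
case=> e1 e2 e3 e4 e5; have e3' := e3; rewrite card_proj_slice in e3'.
have eA : #|proj1G K| = x1 * x3.
  by rewrite -e3 -e1 mulnC divnK // cardSg ?normal_sub ?slice1_normal.
have eC : #|proj2G K| = x3 * x4.
  by rewrite -e3' -e4 divnK // cardSg ?normal_sub ?slice2_normal.
have em : x1 * x3 * x2 = m by rewrite -eA -e2 mulnC divnK // cardSg ?subsetT.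
have en : x3 * x4 * x5 = n by rewrite -eC -e5 mulnC divnK // cardSg ?subsetT.
split=> //; apply/quintsP; have := cardG_gt0 [set: gT]; have := cardG_gt0 [set: hT].
rewrite -{1}em -{1}en !muln_gt0 => /andP[/andP[? ?] ?] /andP[/andP[? ?] ?].
by split; [split | split=> //; rewrite -em mulnAC].
Qed.

Lemma quint_of_mem K : quint_of K \in quints m n.
Proof.
case e: (quint_of K) => [[[[x1 x2] x3] x4] x5].
by case: (quint_ofE e).
Qed.

Lemma exists_subgroup_cyclic (rT : finGroupType) (A : {group rT}) d :
  cyclic A -> d %| #|A| -> exists2 B : {group rT}, B \subset A & #|B| = d.
Proof.
case/cyclicP => a eA; rewrite eA => /cycle_sub_group /setP/(_ <[a ^+ (#[a] %/ d)]>%G)%g.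
by rewrite !inE eqxx => /andP[s /eqP e]; exists (<[a ^+ (#[a] %/ d)]>%G)%g.
Qed.

(** A cyclic group has just one subgroup of each possible order, so the quintuple fixes A, B, C, D;
    what remains is to count the automorphisms of the cyclic group A / B of order [x3]. *)
Lemma card_quint_fiber x1 x2 x3 x4 x5 : (x1, x2, x3, x4, x5) \in quints m n ->
  #|[pred K | quint_of K == (x1, x2, x3, x4, x5)]| = totient x3.
Proof.
move=> qx; have [[p1 p2 p3 p4 p5] [em en]] := quintsP _ _ _ _ _ _ _ qx.
have [A _ cA] : exists2 A : {group gT}, A \subset setT & #|A| = x1 * x3.
  by apply: exists_subgroup_cyclic; rewrite // -em mulnAC dvdn_mulr.
have cycA : cyclic A := cyclicS (subsetT A) cG.
have [B sBA cB] : exists2 B : {group gT}, B \subset A & #|B| = x1.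
  by apply: exists_subgroup_cyclic; rewrite // cA dvdn_mulr.
have [C _ cC] : exists2 C : {group hT}, C \subset setT & #|C| = x3 * x4.
  by apply: exists_subgroup_cyclic; rewrite // -en dvdn_mulr.
have cycC : cyclic C := cyclicS (subsetT C) cH.
have [D sDC cD] : exists2 D : {group hT}, D \subset C & #|D| = x4.
  by apply: exists_subgroup_cyclic; rewrite // cC dvdn_mull.
have nBA : (B <| A)%g by rewrite -sub_abelian_normal // cyclic_abelian.
have nDC : (D <| C)%g by rewrite -sub_abelian_normal // cyclic_abelian.
have cAB : #|A / B|%g = x3 by rewrite -divg_normal // cA cB mulKn.
have cCD : #|C / D|%g = x3 by rewrite -divg_normal // cC cD mulnK.
have iso : (A / B \isog C / D)%g.
  by rewrite isog_cyclic_card ?quotient_cyclic // cAB cCD eqxx.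
transitivity #|[pred K | (proj1G K, slice1 K, proj2G K, slice2 K) == (A, B, C, D)]|.
  apply: eq_card => K; rewrite !inE; apply/eqP/eqP => [e|[eA eB eC eD]].
    have uniqG (X Y : {group gT}) : #|X| = #|Y| -> X = Y.
      by move=> e'; apply/val_inj/eqP; rewrite (eq_subG_cyclic cG) ?subsetT ?e'.
    have uniqH (X Y : {group hT}) : #|X| = #|Y| -> X = Y.
      by move=> e'; apply/val_inj/eqP; rewrite (eq_subG_cyclic cH) ?subsetT ?e'.
    have [_ f1 f2 f3 f4] := quint_ofE e.
    by congr (_, _, _, _); [apply: uniqG|apply: uniqG|apply: uniqH|apply: uniqH];
      rewrite ?f1 ?f2 ?f3 ?f4.
  rewrite /quint_of eA eB eC eD cA cB cC cD -em -en.
  rewrite mulKn // mulnAC mulKn ?muln_gt0 ?p1 //.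
  by rewrite [x3 * _ * _]mulnC mulnK ?muln_gt0 ?p3.
rewrite card_goursat_fiber // iso card_Aut_cyclic ?cAB //.
exact: quotient_cyclic.
Qed.

(** For the cyclic groups involved the exponent is the order, whence lcm(x1 x3, x3 x4) = x3 lcm(x1,
    x4) for K and lcm(m / x1, n / x4) = x3 lcm(x2, x5) for the quotient. The function f is left open
    because the lemma serves twice: for the group A of a chain and for the quotient A / B. *)
Lemma sum_subgroups_cyclic_prod (f : nat -> nat -> nat -> nat -> nat) :
  \sum_(K : {group gT * hT}) f #|K| (exponent K)
     #|[set: gT * hT] / K|%g (exponent ([set: gT * hT] / K)%g)
  = \sum_(x <- quints m n) let: (x1, x2, x3, x4, x5) := x in
      totient x3 * f (x1 * x3 * x4) (x3 * lcmn x1 x4) (x2 * x3 * x5) (x3 * lcmn x2 x5).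
Proof.
have aG := cyclic_abelian cG; have aH := cyclic_abelian cH.
pose G (x : nat5) := let: (x1, x2, x3, x4, x5) := x in
  f (x1 * x3 * x4) (x3 * lcmn x1 x4) (x2 * x3 * x5) (x3 * lcmn x2 x5).
rewrite (sum_fibers (quints_uniq m n) quint_of_mem (G := G)); last first.
  move=> K; case e: (quint_of K) => [[[[x1 x2] x3] x4] x5].
  have [qx eB eA eD eC] := quint_ofE e.
  have [[p1 p2 p3 p4 p5] [em en]] := quintsP _ _ _ _ _ _ _ qx.
  have nK : (K <| [set: gT * hT])%g.
    by rewrite -sub_abelian_normal ?subsetT ?prod_cyclic_abelian.
  have cK : #|K| = x1 * x3 * x4 by rewrite card_subprod eA eD.
  rewrite -divg_normal // cK exponent_subprod exponent_quotient_subprod //; last first.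
    exact: prod_cyclic_abelian.
  rewrite (exponent_cyclic (cyclicS (subsetT (proj1G K)) cG)).
  rewrite (exponent_cyclic (cyclicS (subsetT (proj2G K)) cH)).
  rewrite (exponent_cyclic (quotient_cyclic (slice1 K) cG)).
  rewrite (exponent_cyclic (quotient_cyclic (slice2 K) cH)).
  have n1 : (slice1 K <| [set: gT])%g by rewrite -sub_abelian_normal ?subsetT.
  have n2 : (slice2 K <| [set: hT])%g by rewrite -sub_abelian_normal ?subsetT.
  rewrite -(divg_normal n1) -(divg_normal n2) eA eB eC eD /G.
  rewrite [x1 * x3]mulnC -muln_lcmr -[in m %/ _]em -[in n %/ _]en.
  rewrite -[x1 * x2 * x3]mulnA mulKn // [x3 * x4 * x5]mulnAC mulnK //.
  rewrite [x2 * x3]mulnC -muln_lcmr.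
  congr f; rewrite cardsT card_prod -!cardsT -em -en.
  rewrite (_ : x1 * x2 * x3 * (x3 * x4 * x5) = x3 * x1 * x4 * (x3 * x2 * x5)); last by lia.
  by rewrite mulKn // !muln_gt0 p1 p3 p4.
by rewrite !big_seq; apply: eq_bigr => -[[[[x1 x2] x3] x4] x5] qx; rewrite card_quint_fiber.
Qed.

End CyclicProduct.

(** * Chains of subgroups *)

(** Transport along an isomorphism, which lets A be replaced by a model Z_u x Z_v. *)
Lemma sum_normal_isog (gT rT : finGroupType) (A : {group gT}) (A' : {group rT})
    (f : nat -> nat -> nat -> nat) :
  (A \isog A')%g ->
  \sum_(B : {group gT} | (B <| A)%g) f #|B| #|A / B|%g (exponent (A / B)%g)
  = \sum_(B : {group rT} | (B <| A')%g) f #|B| #|A' / B|%g (exponent (A' / B)%g).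
Proof.
case/isogP => g injg img.
rewrite [RHS](reindex_onto (fun B : {group gT} => (g @* B)%G)
                           (fun B : {group rT} => (g @*^-1 B)%G)) /=; last first.
  by move=> B nBA'; apply/val_inj; rewrite /= morphpreK // img normal_sub.
apply: eq_big => [B|B nBA].
  apply/idP/andP => [nBA|[nBA' /eqP eB]].
    split; first by rewrite -img; exact: morphim_normal.
    by apply/eqP/val_inj; rewrite /= injmK // normal_sub.
  (* A preimage under [g] lies in the domain A. *)
  have sBA : B \subset A by rewrite -eB subsetIl.
  by rewrite -(injm_normal injg) // img.
have iso : ((A / B)%g \isog (g @* A / g @* B)%g)%g.
  apply/isogP; exists (quotm_morphism g nBA); first exact: injm_quotm.
  by rewrite morphim_quotm.
by rewrite (card_injm injg) ?normal_sub // (card_isog iso) (exponent_isog iso) /= img.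
Qed.

Lemma cyclic_cyc n : cyclic [set: cyc n].
Proof. by rewrite Zp_cycle cycle_cyclic. Qed.

Lemma card_cyc n : 0 < n -> #|[set: cyc n]| = n.
Proof. by move=> n0; rewrite cardsT card_ord prednK. Qed.

Lemma abelian_cyc2 u v : abelian [set: cyc u * cyc v].
Proof. by apply: prod_cyclic_abelian; apply: cyclic_abelian; exact: cyclic_cyc. Qed.

Lemma rank_cyc2 u v : 'r([set: cyc u * cyc v])%g <= 2.
Proof. exact: rank_prod_cyclic (cyclic_cyc u) (cyclic_cyc v). Qed.

(** Here u = |G| / v divides v, so Z_u x Z_v has exponent lcm(u, v) = v, and order and exponent
    decide. *)
Lemma rank2_isog_cyc (gT : finGroupType) (G : {group gT}) (u v : nat) :
  abelian G -> 'r(G)%g <= 2 -> u * v = #|G| -> v = exponent G ->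
  (G \isog [set: cyc u * cyc v])%g.
Proof.
move=> cGG rG cG eG; have v0 : 0 < v by rewrite eG exponent_gt0.
have u0 : 0 < u by have := cardG_gt0 G; rewrite -cG muln_gt0 => /andP[].
have dv : u %| v.
  by have := exponent_rank2_dvdn cGG rG; rewrite -cG -eG mulnK.
rewrite (rank2_isog cGG (abelian_cyc2 u v) rG (rank_cyc2 u v)).
rewrite cardsT card_prod -!cardsT !card_cyc // cG eqxx /= -eG.
rewrite exponent_subprod.
have surj1 : proj1G [set: cyc u * cyc v] = [set: cyc u]%G.
  by apply/val_inj/setP => x; rewrite inE; apply/proj1GP; exists 1%g; rewrite inE.
have surj2 : proj2G [set: cyc u * cyc v] = [set: cyc v]%G.
  by apply/val_inj/setP => x; rewrite inE; apply/proj2GP; exists 1%g; rewrite inE.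
rewrite surj1 surj2 !exponent_cyclic ?cyclic_cyc // !card_cyc //.
by rewrite (lcmn_idPr dv).
Qed.

(** Order divided by exponent: this produces gcd(x1, x4) for a subgroup A and u = gcd(y2, y5) for a
    quotient A / B. *)
Lemma mul_divn_lcm a b c : 0 < a -> 0 < b -> 0 < c ->
  (b * a * c) %/ (a * lcmn b c) = gcdn b c.
Proof.
move=> a0 b0 c0; rewrite [b * a]mulnC -mulnA -(muln_lcm_gcd b c) mulnA mulKn //.
by rewrite muln_gt0 a0 lcmn_gt0 b0.
Qed.

(** Data of chains B <= A in Z_m x Z_n: x records A, and y records the image of B in the model of
    A. *)
Definition quint_pairs (m n : nat) : seq (nat5 * nat5) :=
  [seq (x, y) | x <- quints m n,
                y <- let: (x1, x2, x3, x4, x5) := x in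
                     quints (gcdn x1 x4) (x3 * lcmn x1 x4)].

Lemma quint_pairs_uniq m n : uniq (quint_pairs m n).
Proof.
apply: allpairs_uniq_dep; first exact: quints_uniq.
  by move=> [[[[x1 x2] x3] x4] x5] _; exact: quints_uniq.
by move=> [x y] [x' y'] _ _ /= [-> ->].
Qed.

Definition chain_weight (w : nat5 * nat5) : nat :=
  let: (x1, x2, x3, x4, x5) := w.1 in let: (y1, y2, y3, y4, y5) := w.2 in
  totient x3 * totient y3.

(** The arguments of [f] are |A|, |B|, |A / B| and the exponent of A / B. *)
Definition chain_data (A : Type) (f : nat -> nat -> nat -> nat -> A)
    (w : nat5 * nat5) : A :=
  let: (x1, x2, x3, x4, x5) := w.1 in let: (y1, y2, y3, y4, y5) := w.2 in
  f (x1 * x3 * x4) (y1 * y3 * y4) (y2 * y3 * y5) (y3 * lcmn y2 y5).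

Lemma sum_subgroups_cyc2 u v (f : nat -> nat -> nat -> nat) :
  0 < u -> 0 < v ->
  \sum_(B : {group cyc u * cyc v} | (B <| [set: cyc u * cyc v])%g)
    f #|B| #|[set: cyc u * cyc v] / B|%g (exponent ([set: cyc u * cyc v] / B)%g)
  = \sum_(y <- quints u v) let: (y1, y2, y3, y4, y5) := y in
      totient y3 * f (y1 * y3 * y4) (y2 * y3 * y5) (y3 * lcmn y2 y5).
Proof.
move=> u0 v0.
rewrite [LHS](eq_bigl predT); last first.
  by move=> B; rewrite -sub_abelian_normal ?abelian_cyc2 ?subsetT.
have := sum_subgroups_cyclic_prod (cyclic_cyc u) (cyclic_cyc v) (fun a _ b c => f a b c).
by rewrite !card_cyc.
Qed.

(** The inner sum depends on A only through its order a and exponent e, which fix A up to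
    isomorphism; it is [g a e], computed in the model Z_(a/e) x Z_e. The sum over A is then again
    one over quintuples. *)
Lemma sum_subgroup_chains m n (f : nat -> nat -> nat -> nat -> nat) :
  0 < m -> 0 < n ->
  \sum_(A : {group cyc m * cyc n}) \sum_(B : {group cyc m * cyc n} | (B <| A)%g)
    f #|A| #|B| #|A / B|%g (exponent (A / B)%g)
  = \sum_(w <- quint_pairs m n) chain_weight w * chain_data f w.
Proof.
move=> m0 n0.
pose g a e := \sum_(y <- quints (a %/ e) e) let: (y1, y2, y3, y4, y5) := y in
  totient y3 * f a (y1 * y3 * y4) (y2 * y3 * y5) (y3 * lcmn y2 y5).
transitivity (\sum_(A : {group cyc m * cyc n}) g #|A| (exponent A)).
  apply: eq_bigr => A _.
  have aA : abelian A := abelianS (subsetT A) (abelian_cyc2 m n).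
  have rA : 'r(A)%g <= 2 := leq_trans (rankS (subsetT A)) (rank_cyc2 m n).
  have eu : #|A| %/ exponent A * exponent A = #|A| by rewrite divnK ?exponent_dvdn.
  have iso := rank2_isog_cyc aA rA eu erefl.
  rewrite (sum_normal_isog (f #|A|) iso) sum_subgroups_cyc2 ?exponent_gt0 //.
  by rewrite divn_gt0 ?exponent_gt0 // dvdn_leq ?exponent_dvdn.
have := sum_subgroups_cyclic_prod (cyclic_cyc m) (cyclic_cyc n) (fun a e _ _ => g a e).
rewrite !card_cyc // => ->; rewrite big_allpairs_dep !big_seq.
apply: eq_bigr => -[[[[x1 x2] x3] x4] x5] /quintsP[[p1 p2 p3 p4 p5] _].
rewrite /g mul_divn_lcm // big_distrr /=.
apply: eq_bigr => -[[[[y1 y2] y3] y4] y5] _.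
by rewrite /chain_weight /chain_data /= mulnA.
Qed.

(** * Subgroups of rank-four groups *)

Lemma card_order_isog (gT rT : finGroupType) k :
  abelian [set: gT] -> ([set: gT] \isog [set: rT])%g ->
  #|[pred H : {group gT} | #|H| == k]| = #|[pred H : {group rT} | #|H| == k]|.
Proof.
move=> cG iso; have cR : abelian [set: rT] by rewrite -(isog_abelian iso).
have sumE (T : finGroupType) : abelian [set: T] ->
    #|[pred H : {group T} | #|H| == k]|
    = \sum_(H : {group T} | (H <| [set: T])%g) (#|H| == k).
  move=> cT; rewrite -sum1_card big_mkcond [RHS]big_mkcond; apply: eq_bigr => H _ /=.
  by rewrite -sub_abelian_normal ?subsetT //= inE; case: eqP.
by rewrite !sumE // (sum_normal_isog (fun c _ _ => (c == k) : nat) iso).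
Qed.

(** The fourfold product associates to the left, whereas Goursat's lemma is to be applied to two
    factors of rank at most 2. *)
Lemma prod_assoc_isog (aT bT cT dT : finGroupType) :
  ([set: aT * bT * cT * dT] \isog [set: (aT * bT) * (cT * dT)])%g.
Proof.
pose f (x : aT * bT * cT * dT) := (x.1.1, (x.1.2, x.2)).
have fM : {in [set: aT * bT * cT * dT]%g &, {morph f : x y / (x * y)%g}} by [].
apply/isogP; exists (Morphism fM).
  by apply/injmP => -[[[a b] c] d] [[[a' b'] c'] d'] _ _ [] -> -> -> ->.
apply/setP => -[[a b] [c d]]; rewrite inE; apply/morphimP.
by exists (a, b, c, d); rewrite ?inE.
Qed.

Lemma rank_quotient_leq (gT : finGroupType) (A B : {group gT}) :
  abelian A -> (B <| A)%g -> 'r(A / B)%g <= 'r(A)%g.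
Proof.
move=> cA nBA; rewrite -(grank_abelian cA) -grank_abelian ?quotient_abelian //.
exact: quotient_grank (normal_norm nBA).
Qed.

(** The quotients are abelian of rank at most 2, so isomorphism becomes equality of order and
    exponent, and A / B may be replaced by its model inside [numAut]. *)
Lemma card_subgroups_goursat (m n r s k : nat) :
  #|[pred L : {group (cyc m * cyc n) * (cyc r * cyc s)} | #|L| == k]|
  = \sum_(A : {group cyc m * cyc n}) \sum_(B : {group cyc m * cyc n} | (B <| A)%g)
    \sum_(C : {group cyc r * cyc s}) \sum_(D : {group cyc r * cyc s} | (D <| C)%g)
      (#|A| * #|D| == k)
      * ((#|A / B|%g == #|C / D|%g) && (exponent (A / B)%g == exponent (C / D)%g))
      * numAut (#|A / B|%g %/ exponent (A / B)%g) (exponent (A / B)%g).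
Proof.
rewrite -sum1_card big_mkcond /=.
rewrite (eq_bigr (fun L => (#|proj1G L| * #|slice2 L| == k) : nat)); last first.
  by move=> L _; rewrite inE -card_subprod; case: eqP.
rewrite (sum_goursat (fun A B C D => (#|A| * #|D| == k) : nat)).
have sub_rank2 u v (A B : {group cyc u * cyc v}) : (B <| A)%g ->
    abelian (A / B)%g /\ 'r(A / B)%g <= 2.
  move=> nBA; have cA : abelian A := abelianS (subsetT A) (abelian_cyc2 u v).
  split; first exact: quotient_abelian.
  apply: leq_trans (rank_quotient_leq cA nBA) _.
  exact: leq_trans (rankS (subsetT A)) (rank_cyc2 u v).
apply: eq_bigr => A _; apply: eq_bigr => B nBA.
apply: eq_bigr => C _; apply: eq_bigr => D nDC.
have [cAB rAB] := sub_rank2 _ _ _ _ nBA; have [cCD rCD] := sub_rank2 _ _ _ _ nDC.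
rewrite (rank2_isog cAB cCD rAB rCD); congr (_ * _); rewrite /numAut.
have eu : #|A / B|%g %/ exponent (A / B)%g * exponent (A / B)%g = #|A / B|%g.
  by rewrite divnK ?exponent_dvdn.
have /isogP[g injg img] := rank2_isog_cyc cAB rAB eu erefl.
by have := card_isog (injm_Aut injg (subxx _)); rewrite /= img => <-.
Qed.

Lemma quint_pairsP m n x1 x2 x3 x4 x5 y1 y2 y3 y4 y5 :
  reflect ([/\ pos5 (x1, x2, x3, x4, x5) & pos5 (y1, y2, y3, y4, y5)] /\
           [/\ x1 * x2 * x3 = m, x3 * x4 * x5 = n,
               y1 * y2 * y3 = gcdn x1 x4 & y3 * y4 * y5 = x3 * lcmn x1 x4])
          (((x1, x2, x3, x4, x5), (y1, y2, y3, y4, y5)) \in quint_pairs m n).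
Proof.
apply: (iffP allpairsPdep) => [[x [y [qx + [ex ey]]]]|[[px py] [em en eg el]]].
  move: qx; rewrite -{}ex -{}ey => /quintsP[px [em en]] /quintsP[py [eg el]].
  by split.
by do 2!eexists; split; [| |reflexivity]; apply/quintsP.
Qed.

Theorem theorem4 (k m n r s : nat)
    (hk : 0 < k) (hm : 0 < m) (hn : 0 < n) (hr : 0 < r) (hs : 0 < s)
    (hkdvd : k %| m * n * r * s) :
  numSubgroups m n r s k
  = \big[addn/0%N]_(w \in indices m n r s k) summand w.
Proof.
(* The arguments stand for |A|, |B|, |A / B| and its exponent, then |C|, |D|, |C / D| and its
   exponent. *)
pose h (a b q e c d q' e' : nat) : nat :=
  (a * d == k) * ((q == q') && (e == e')) * numAut (q %/ e) e.
transitivity (\sum_(w <- quint_pairs m n) chain_weight w * chain_data (fun a b q e =>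
    \sum_(w' <- quint_pairs r s) chain_weight w' * chain_data (h a b q e) w') w).
  rewrite /numSubgroups (card_order_isog _ _ (prod_assoc_isog _ _ _ _)); last first.
    by do ?apply: prod_cyclic_abelian; apply: cyclic_abelian; exact: cyclic_cyc.
  rewrite card_subgroups_goursat -sum_subgroup_chains //.
  apply: eq_bigr => A _; apply: eq_bigr => B _.
  by rewrite -sum_subgroup_chains.
(* These conditions tie the two chains together; the others are built into [quint_pairs]. *)
pose good (w : nat5 * nat5 * nat5 * nat5) : bool :=
  let: (x, y, z, t) := w in
  let: (x1, x2, x3, x4, x5) := x in let: (y1, y2, y3, y4, y5) := y in
  let: (z1, z2, z3, z4, z5) := z in let: (t1, t2, t3, t4, t5) := t in
  [&& gcdn y2 y5 == gcdn t2 t5, y3 * lcmn y2 y5 == t3 * lcmn t2 t5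
    & x1 * x3 * x4 * t1 * t3 * t4 == k].
pose all4 := [seq (p.1, p.2, q.1, q.2) | p <- quint_pairs m n, q <- quint_pairs r s].
have uniq4 : uniq [seq w <- all4 | good w].
  apply/filter_uniq/allpairs_uniq; try exact: quint_pairs_uniq.
  by move=> [[x y] [z t]] [[x' y'] [z' t']] _ _ /= [-> -> -> ->].
(* With the index set presented by a duplicate-free list, the sum over the set becomes a sum over
   that list. *)
have mem4 : [set` [seq w <- all4 | good w]]%classic = indices m n r s k.
  apply/seteqP; split => -[[[[[[[x1 x2] x3] x4] x5] [[[[y1 y2] y3] y4] y5]]
      [[[[z1 z2] z3] z4] z5]] [[[[t1 t2] t3] t4] t5]] /=; rewrite mem_filter.
    case/andP=> /and3P[/eqP eu /eqP ev /eqP ek] /allpairsP[[[x y] [z t]] /= [qx qz]].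
    case=> ex ey ez et; move: qx qz; rewrite -{}ex -{}ey -{}ez -{}et.
    by move=> /quint_pairsP[[px py] [e1 e2 e3 e4]] /quint_pairsP[[pz pt] [e5 e6 e7 e8]].
  case=> [[px py pz pt] [e1 [e2 [e3 [e4 [e5 [e6 [e7 [e8 [e9 [e10 e11]]]]]]]]]]].
  rewrite /good e9 e10 e11 !eqxx /=; apply/allpairsP.
  exists (((x1, x2, x3, x4, x5), (y1, y2, y3, y4, y5)),
          ((z1, z2, z3, z4, z5), (t1, t2, t3, t4, t5))).
  by split=> //; apply/quint_pairsP.
rewrite -mem4 -fsbig_seq // big_filter [RHS]big_mkcond [RHS]big_allpairs_dep.
rewrite [LHS]big_seq [RHS]big_seq.
apply: eq_bigr => -[[[[[x1 x2] x3] x4] x5] [[[[y1 y2] y3] y4] y5]].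
move=> /quint_pairsP[[_ [py1 py2 py3 py4 py5]] _].
rewrite /chain_data /chain_weight /= big_distrr /= [LHS]big_seq [RHS]big_seq.
apply: eq_bigr => -[[[[[z1 z2] z3] z4] z5] [[[[t1 t2] t3] t4] t5]].
move=> /quint_pairsP[[_ [pt1 pt2 pt3 pt4 pt5]] _].
rewrite /h mul_divn_lcm // /good /=.
(* The order y2 y3 y5 of A / B is v u; once the positive exponents v agree, equal orders amount to
   equal u. *)
have fac a b c : b * a * c = a * lcmn b c * gcdn b c.
  by rewrite -[RHS]mulnA muln_lcm_gcd mulnCA mulnA.
have -> : (y2 * y3 * y5 == t2 * t3 * t5) && (y3 * lcmn y2 y5 == t3 * lcmn t2 t5)
    = (gcdn y2 y5 == gcdn t2 t5) && (y3 * lcmn y2 y5 == t3 * lcmn t2 t5).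
  rewrite (fac y3) (fac t3); case: (y3 * lcmn y2 y5 =P t3 * lcmn t2 t5) => [->|].
    by rewrite eqn_pmul2l // muln_gt0 pt3 lcmn_gt0 pt2.
  by rewrite !andbF.
rewrite !mulnA andbA; case: andP => _; case: eqP => _ /=;
  by rewrite ?muln0 ?mul0n ?muln1 // -!mulnA.
Qed.
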